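(* Let $X$ be a non-negative continuous random variable with density $f$, distribution function $F$ and finite mean, and let $X_1,X_2$ be two independent random variables each having distribution function $F$. Then $$\frac12\int_0^\infty \big(1-F^2(x)\big)\,dx=\frac12\,E\big(\max(X_1,X_2)\big).$$
   Context: The left-hand side is the negative cumulative extropy of $X$. Here $F^2(x)$ means $(F(x))^2$. *)

(* Defs.v *)
From HB Require Import structures.
From mathcomp Require Import all_boot all_order all_algebra.
From mathcomp Require Import all_classical all_reals all_analysis.

Set Implicit Arguments.
Unset Strict Implicit.
Unset Printing Implicit Defensive.

Import Order.TTheory GRing.Theory Num.Theory.
Import numFieldNormedType.Exports.

Local Open Scope classical_set_scope.
Local Open Scope ring_scope.
Local Open Scope ereal_scope.

Definition is_density (d : measure_display) (T : measurableType d)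
    (R : realType) (P : probability T R) (X : {RV P >-> R}) (f : R -> R) :=
  [/\ measurable_fun [set: R] f,
      (forall x, (0 <= f x)%R) &
      (forall A : set R, measurable A ->
        distribution P X A = \int[lebesgue_measure]_(x in A) (f x)%:E)].

(* The library's [cdf] takes values in [\bar R]; [F] is its real-valued form. *)
Definition is_distribution_function (d : measure_display)
    (T : measurableType d) (R : realType) (P : probability T R)
    (X : {RV P >-> R}) (F : R -> R) :=
  forall x, cdf X x = (F x)%:E.

Definition independent_RVs (d : measure_display) (T : measurableType d)
    (R : realType) (P : probability T R) (X Y : {RV P >-> R}) :=
  forall A B : set R, measurable A -> measurable B ->
    P (X @^-1` A `&` Y @^-1` B) = P (X @^-1` A) * P (Y @^-1` B).

(* Main.v *)
Require Import Defs.
From HB Require Import structures.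
From mathcomp Require Import all_boot all_order all_algebra.
From mathcomp Require Import all_classical all_reals all_analysis.
From mathcomp Require Import measurable_realfun.

Set Implicit Arguments.
Unset Strict Implicit.
Unset Printing Implicit Defensive.

Import Order.TTheory GRing.Theory Num.Theory.
Import numFieldNormedType.Exports.

Local Open Scope classical_set_scope.
Local Open Scope ring_scope.
Local Open Scope ereal_scope.

(** By independence [max(X1, X2)] has distribution function [F ^ 2], so the
    identity is the tail formula for its expectation. Nonnegativity is known for
    [X] only; it passes to [X1] through [F 0 = 0], which holds because [X] has a
    density and hence no atom at 0. *)

(** []-oo, 0]] splits into []-oo, 0[], which [X] almost surely avoids, and the point 0, which is
    Lebesgue-null and hence null for a law with a density. *)
Lemma density_cdf0 (R : realType) (d : measure_display) (T : measurableType d)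
    (P : probability T R) (X : {RV P >-> R}) (f : R -> R) :
  {ae P, forall t, (0 <= X t)%R} -> is_density X f -> cdf X 0%R = 0.
Proof.
move=> X_ge0 [_ _ Xf].
apply/eqP; rewrite -measure_le0 /=.
have PX_lt0 : P (X @^-1` `]-oo, 0%R[) = 0.
  apply: measure_negligible; first exact: measurable_funPTI.
  apply: negligibleS X_ge0 => t /=; rewrite in_itv/= => Xt0.
  by apply/negP; rewrite -ltNge.
have PX_eq0 : distribution P X [set 0%R] = 0.
  by rewrite Xf// integral_set1.
rewrite -(setUitv1 true)//.
rewrite (le_trans (measureU2 _ _ _))//.
by rewrite [X in X + _]PX_lt0 [X in _ + X]PX_eq0 adde0.
Qed.

(** [X1] and [X] may live on different probability spaces and share only [F], so the sign of [X1]
    has to be recovered from a value of its distribution function. *)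
Lemma cdf0_ae_gt0 (R : realType) (d : measure_display) (T : measurableType d)
    (P : probability T R) (X : {RV P >-> R}) :
  cdf X 0%R = 0 -> {ae P, forall t, (0 < X t)%R}.
Proof.
move=> X0; exists (X @^-1` `]-oo, 0%R]); split => //; first exact: measurable_funPTI.
by move=> t /=; rewrite in_itv/= => /negP; rewrite -leNgt.
Qed.

(** The maximum is at most [r] exactly when both variables are, so its event is an intersection to
    which independence applies. *)
Lemma independent_cdf_max (R : realType) (d : measure_display)
    (T : measurableType d) (P : probability T R) (X Y : {RV P >-> R}) (r : R) :
  independent_RVs X Y -> cdf (max_mfun X Y : {RV P >-> R}) r = cdf X r * cdf Y r.
Proof.
move=> XY; rewrite /cdf /distribution /= /pushforward -XY//.
by congr (P _); apply/seteqP; split => t /=;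
  rewrite !in_itv/= ge_max => /andP.
Qed.

(** [ge0_expectation_ccdf] asks for nonnegativity at every point; the positive part has it and
    agrees with [X] almost everywhere. *)
Lemma ae_ge0_expectation_ccdf (R : realType) (d : measure_display)
    (T : measurableType d) (P : probability T R) (X : {RV P >-> R}) :
  {ae P, forall t, (0 <= X t)%R} ->
  'E_P[X] = \int[lebesgue_measure]_(r in `[0%R, +oo[) ccdf X r.
Proof.
move=> X_ge0; transitivity ('E_P[X^\+%R]).
  rewrite unlock; apply: ae_eq_integral => //.
  - exact/measurable_EFinP.
  - exact/measurable_EFinP/measurable_funrpos.
  - apply: filterS X_ge0 => t Xt0 _; congr EFin.
    by apply/esym/max_idPl.
rewrite (@ge0_expectation_ccdf _ _ _ P X^\+%R); last first.
  by move=> ?; exact: funrpos_ge0.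
(* For [r >= 0], [max(X t, 0) > r] amounts to [X t > r], so the positive part has the same tail. *)
apply: eq_integral => r /[!inE]/= r0y; congr (P _).
by apply/seteqP; split => t /=;
  rewrite !in_itv/= !andbT lt_max (le_gtF (_ : 0 <= r)%R) ?(itvP r0y) ?orbF.
Qed.

Theorem mainTheorem4 (R : realType)
  (d : measure_display) (T : measurableType d) (P : probability T R)
  (X : {RV P >-> R}) (f F : R -> R)
  (X_ge0 : {ae P, forall t, (0 <= X t)%R})
  (X_density : is_density X f)
  (X_F : is_distribution_function X F)
  (X_mean : P.-integrable [set: T] (EFin \o X))
  (d' : measure_display) (T' : measurableType d') (Q : probability T' R)
  (X1 X2 : {RV Q >-> R})
  (X1_F : is_distribution_function X1 F)
  (X2_F : is_distribution_function X2 F)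
  (X12_indep : independent_RVs X1 X2) :
  (2^-1)%:E * \int[lebesgue_measure]_(x in `[0%R, +oo[) (1 - F x ^+ 2)%:E
  = (2^-1)%:E * 'E_Q[(fun t => Num.max (X1 t) (X2 t))].
Proof.
have X1_gt0 : {ae Q, forall t, (0 < X1 t)%R}.
  by apply: cdf0_ae_gt0; rewrite X1_F -X_F (density_cdf0 X_ge0 X_density).
(* [max_mfun X1 X2] is the pointwise maximum packaged as a random variable. *)
congr (_ * _); rewrite (@ae_ge0_expectation_ccdf _ _ _ _ (max_mfun X1 X2)); last first.
  by apply: filterS X1_gt0 => t /ltW X1t; rewrite le_max X1t.
apply: eq_integral => x _.
by rewrite ccdf_1_cdf independent_cdf_max// X1_F X2_F expr2 EFinB EFinM.
Qed.
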